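(* Let $k\ge 2$ and $n_1,\ldots,n_k\ge 2$ be integers. Then \[ \mathrm{gp}(K_{n_1}\,\square\,\cdots\,\square\,K_{n_k})\ge n_1+\cdots+n_k-k . \] Moreover, for $k=2$, $\mathrm{gp}(K_{n_1}\,\square\,K_{n_2})=n_1+n_2-2$.
   Context: Graphs are finite, undirected and simple. $K_n$ is the complete graph on $n$ vertices. The Cartesian product $G\,\square\,H$ has vertex set $V(G)\times V(H)$, and $(g,h)$, $(g',h')$ are adjacent if either $gg'\in E(G)$ and $h=h'$, or $g=g'$ and $hh'\in E(H)$; it is associative up to isomorphism. For a graph $G$, $d_G$ is the shortest-path distance; a $u,v$-geodesic is a $u,v$-path of length $d_G(u,v)$. A set $S\subseteq V(G)$ is a general position set of $G$ if no vertex of $S$ lies on a geodesic between two other vertices of $S$. The general position number $\mathrm{gp}(G)$ is the maximum cardinality of a general position set of $G$. *)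

(* Defs.v *)
From mathcomp Require Import all_boot.

Set Implicit Arguments.
Unset Strict Implicit.
Unset Printing Implicit Defensive.

Record sgraph := SGraph {
  vertex :> finType;
  edge : rel vertex;
  edge_sym : symmetric edge;
  edge_irrefl : irreflexive edge }.

Definition complete_edge (n : nat) : rel 'I_n := fun x y => x != y.

Lemma complete_edge_sym (n : nat) : symmetric (@complete_edge n).
Proof. by move=> x y; rewrite /complete_edge eq_sym. Qed.

Lemma complete_edge_irrefl (n : nat) : irreflexive (@complete_edge n).
Proof. by move=> x; rewrite /complete_edge eqxx. Qed.

Definition complete (n : nat) : sgraph :=
  SGraph (@complete_edge_sym n) (@complete_edge_irrefl n).

Section Cartesian.
Variables G H : sgraph.

Definition cartesian_edge : rel (G * H) := fun x y =>
  (edge x.1 y.1 && (x.2 == y.2)) || ((x.1 == y.1) && edge x.2 y.2).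

Lemma cartesian_edge_sym : symmetric cartesian_edge.
Proof.
move=> x y; rewrite /cartesian_edge (edge_sym x.1) (edge_sym x.2).
by rewrite (eq_sym x.1) (eq_sym x.2).
Qed.

Lemma cartesian_edge_irrefl : irreflexive cartesian_edge.
Proof. by move=> x; rewrite /cartesian_edge !edge_irrefl andbF. Qed.

Definition cartesian : sgraph :=
  SGraph cartesian_edge_sym cartesian_edge_irrefl.
End Cartesian.

(* Bracketed to the right, with no trailing trivial factor:                   *)
(* cartesian_seq [:: G1; G2; G3] is cartesian G1 (cartesian G2 G3).           *)
Fixpoint cartesian_seq (s : seq sgraph) : sgraph :=
  match s with
  | [::] => complete 1
  | [:: G] => G
  | G :: s' => cartesian G (cartesian_seq s')
  end.

Section GeneralPosition.
Variable G : sgraph.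

(* The path has vertex sequence u :: p, hence length size p.                  *)
Definition upath (u v : G) (p : seq G) : bool :=
  [&& path (@edge G) u p, last u p == v & uniq (u :: p)].

(* The default value #|G|, for u and v in different components, is never the  *)
(* length of a path, since a path has at most #|G| vertices.                  *)
Definition dist (u v : G) : nat :=
  find (fun l => [exists p : l.-tuple G, upath u v p]) (iota 0 #|G|).

Definition on_geodesic (w u v : G) : bool :=
  [exists p : (dist u v).-tuple G, upath u v p && (w \in u :: p)].

Definition general_position (S : {set G}) : bool :=
  [forall w in S, forall u in S, forall v in S,
    [&& w != u, w != v & u != v] ==> ~~ on_geodesic w u v].

Definition gp : nat := \max_(S : {set G} | general_position S) #|S|.
End GeneralPosition.

(* Main.v *)
Require Import Defs.
From mathcomp Require Import all_boot.

Set Implicit Arguments.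
Unset Strict Implicit.
Unset Printing Implicit Defensive.

(** For the lower bound, fix a root vertex of the product: the vertices that
    differ from it in exactly one coordinate are all adjacent to the root, and
    adjacency is transitive among them.  Two of them are thus at distance at
    most 2, and the middle vertex of a geodesic of length 2 cannot be a third
    one.

    For the upper bound with two factors, the corner of an axis-parallel right
    triangle is on a geodesic between the two other vertices, so every point of
    a general position set is alone in its row or alone in its column.  Let [R]
    be the points alone in their row and [C] the other ones.  The points of [R]
    occupy distinct rows, those of [C] distinct columns, and no point of [R]
    shares a row or a column with a point of [C]. *)

Lemma upath_size (G : sgraph) (u v : G) (p : seq G) :
  upath u v p -> size p < #|G|.
Proof. by case/and3P=> _ _ /card_uniqP/= <-; apply: max_card. Qed.

Lemma dist_le (G : sgraph) (u v : G) (p : seq G) :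
  upath u v p -> dist u v <= size p.
Proof.
move=> Hp; have lt_p := upath_size Hp; rewrite leqNgt; apply/negP.
move/(before_find 0); rewrite nth_iota // add0n => /existsP[].
by exists (in_tuple p).
Qed.

(** Any path rules out the default value [#|G|], so [find] stops at a length that a path
    realises. *)
Lemma dist_upath (G : sgraph) (u v : G) (p : seq G) :
  upath u v p -> exists q : (dist u v).-tuple G, upath u v q.
Proof.
move=> Hp; apply/existsP; have lt_p := upath_size Hp.
have lt_d : dist u v < #|G| := leq_ltn_trans (dist_le Hp) lt_p.
pose a l := [exists q : l.-tuple G, upath u v q].
have : has a (iota 0 #|G|).
  by apply/hasP; exists (size p); rewrite ?mem_iota //; apply/existsP; exists (in_tuple p).
by move/(nth_find 0); rewrite nth_iota.
Qed.

Lemma edge_neq (G : sgraph) (u v : G) : edge u v -> u != v.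
Proof. by apply: contraTneq => ->; rewrite edge_irrefl. Qed.

Lemma upath1 (G : sgraph) (u v : G) : edge u v -> upath u v [:: v].
Proof. by move=> uv; rewrite /upath /= uv eqxx inE edge_neq. Qed.

Lemma upath2 (G : sgraph) (u w v : G) :
  edge u w -> edge w v -> u != v -> upath u v [:: w; v].
Proof.
by move=> uw wv uv; rewrite /upath /= uw wv eqxx !inE negb_or uv !edge_neq.
Qed.

Lemma on_geodesic_common_neighbour (G : sgraph) (u w v : G) :
  edge u w -> edge w v -> u != v -> ~~ edge u v -> on_geodesic w u v.
Proof.
move=> uw wv uv nuv; have Hp := upath2 uw wv uv.
have dist2 : dist u v = 2.
  have := dist_le Hp; have [q] := dist_upath Hp.
  (* Length 0 would give [u = v], and length 1 an edge between [u] and [v]. *)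
  case: (dist u v) q => [|[|[|d]]] // [[|x [|y q]]] //= _ /and3P[/=].
    by rewrite (negPf uv).
  by rewrite andbT => ux /eqP xv; rewrite xv (negPf nuv) in ux.
apply/existsP; rewrite dist2; exists [tuple w; v].
by rewrite /= Hp !inE eqxx orbT.
Qed.

(** The detour through [r] bounds the distance by 2, so a geodesic has room for [w] only as the
    middle vertex of a path of length 2. *)
Lemma on_geodesic_inner (G : sgraph) (r u w v : G) :
  edge r u -> edge r v -> u != v -> w != u -> w != v -> on_geodesic w u v ->
  [/\ edge u w, edge w v & ~~ edge u v].
Proof.
move=> ru rv uv wu wv /existsP[q /andP[]].
have := @dist_le _ u v _ (upath2 (etrans (edge_sym u r) ru) rv uv).
have le1 : edge u v -> dist u v <= 1 by move/upath1/dist_le.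
case: (dist u v) le1 q => [|[|[|d]]] // le1 [[|x [|y [|z q]]]] //= _ _ /and3P[/=].
- by move=> _ /eqP e; rewrite e eqxx in uv.
- by move=> _ /eqP-> _; rewrite !inE (negPf wu) (negPf wv).
rewrite andbT => /andP[ux xy] /eqP y_v _; rewrite y_v in xy *.
rewrite !inE (negPf wu) (negPf wv) orbF /= => /eqP->; split=> //.
by apply/negP => /le1.
Qed.

(** Equivalently, [S] lies in the neighbourhood of [r] and induces a disjoint union of cliques. The
    root is explicit because products glue clusters at it. *)
Definition rooted_cluster (G : sgraph) (r : G) (S : {set G}) : Prop :=
  {in S, forall u, edge r u} /\
  {in S & &, forall w u v, edge u w -> edge w v -> u != v -> edge u v}.

Lemma rooted_cluster_gp (G : sgraph) (r : G) (S : {set G}) :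
  rooted_cluster r S -> #|S| <= gp G.
Proof.
move=> [rS trS]; apply: (@leq_bigmax_cond _ _ (fun S : {set G} => #|S|)).
apply/forall_inP=> w Sw; apply/forall_inP=> u Su; apply/forall_inP=> v Sv.
apply/implyP=> /and3P[wu wv uv]; apply/negP.
move/(on_geodesic_inner (rS u Su) (rS v Sv) uv wu wv) => [uw w_v].
by rewrite (trS w u v).
Qed.

Lemma rooted_cluster_complete (n : nat) : 0 < n ->
  exists (r : complete n) (S : {set complete n}),
    rooted_cluster r S /\ #|S| = n - 1.
Proof.
case: n => // n _; exists (ord0 : 'I_n.+1), [set~ (ord0 : 'I_n.+1)].
split; last by rewrite cardsC1 card_ord subn1.
by split=> // u; rewrite !inE /edge /= /complete_edge eq_sym.
Qed.

(** Place copies of [S] and [T] in the two fibres through [(r, s)]. Since [r] is not in [S] and [s]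
    is not in [T], points of different copies differ in both coordinates: the copies are disjoint,
    with no edge between them. *)
Lemma rooted_cluster_cartesian (G H : sgraph) (r : G) (s : H)
    (S : {set G}) (T : {set H}) :
  rooted_cluster r S -> rooted_cluster s T ->
  exists U : {set cartesian G H},
    rooted_cluster ((r, s) : cartesian G H) U /\ #|U| = #|S| + #|T|.
Proof.
move=> [rS trS] [sT trT].
pose A := [set (x, s) | x in S]; pose B := [set (r, y) | y in T].
have rNS x : x \in S -> (r == x) = false by move/rS/edge_neq/negPf.
have sNT y : y \in T -> (s == y) = false by move/sT/edge_neq/negPf.
exists (A :|: B); split; last first.
  rewrite cardsU [A :&: B](_ : _ = set0) ?cards0 ?subn0.
    by rewrite !card_imset // => x y [].
  apply/setP=> z; rewrite !inE; apply/negP=> /andP[/imsetP[x Sx ->]].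
  by case/imsetP=> y _ [xr]; have := rNS x Sx; rewrite xr eqxx.
split=> [u | w u v].
  rewrite inE => /orP[] /imsetP[x Hx ->]; rewrite /edge /= /cartesian_edge /=.
    by rewrite rS // eqxx.
  by rewrite sT // eqxx orbT.
rewrite !inE /edge /= /cartesian_edge.
(* In the mixed cases one of the two assumed edges would join different copies. Only the cases with
   all three points in one copy remain. *)
by do 3![case/orP=> /imsetP[? ? ->]];
  rewrite /= ?eqxx ?edge_irrefl ?andbT ?andbF ?orbF ?rNS ?sNT //=
    1?[_ == r]eq_sym 1?[_ == s]eq_sym ?rNS ?sNT ?andbF ?orbF //=;
  rewrite /eq_op /= ?eqxx ?andbT //=; [apply: trS|apply: trT].
Qed.

Lemma rooted_cluster_cartesian_seq (ns : seq nat) : all (leq 1) ns ->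
  exists (r : cartesian_seq (map complete ns)) (S : {set _}),
    rooted_cluster r S /\ #|S| = \sum_(n <- ns) (n - 1).
Proof.
elim: ns => [_|n ns IHns /= /andP[n_gt0 /IHns]].
  by rewrite big_nil; apply: (@rooted_cluster_complete 1).
have [r [S [rS eqS]]] := rooted_cluster_complete n_gt0.
(* A single factor is not a product in [cartesian_seq], so it is treated apart. *)
case: ns {IHns} => [_|m ns [s [T [sT eqT]]]].
  by exists r, S; rewrite big_seq1 eqS.
have [U [rsU eqU]] := rooted_cluster_cartesian rS sT.
by exists (r, s), U; rewrite big_cons -eqT -eqS eqU.
Qed.

Lemma corner_free_card (A B : finType) (S : {set A * B}) :
  1 < #|A| -> 1 < #|B| ->
  {in S & &, forall w u v, w.1 = u.1 -> w.2 = v.2 -> w = u \/ w = v} ->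
  #|S| <= #|A| + #|B| - 2.
Proof.
move=> A2 B2 cfS.
pose R := [set x in S | [forall y in S, (y.1 == x.1) ==> (y == x)]].
pose C := S :\: R.
have cardS : #|S| = #|R| + #|C|.
  rewrite -(cardsID R S); congr (#|pred_of_set _| + _).
  by apply/setIidPr/subsetP=> x; rewrite inE => /andP[].
have RP x y : x \in R -> y \in S -> y.1 = x.1 -> y = x.
  rewrite inE => /andP[_ /forall_inP aloneR] Sy e.
  by apply/eqP; apply: (implyP (aloneR y Sy)); apply/eqP.
(* A point of [C] shares its row (its first coordinate) with another point [u]; a further point in
   its column would make it a corner. *)
have CP x y : x \in C -> y \in S -> x.2 = y.2 -> x = y.
  rewrite !inE => /andP[+ Sx] Sy xy; rewrite Sx /= negb_forall_in.
  case/exists_inP=> u Su; rewrite negb_imply => /andP[/eqP ux].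
  by case: (cfS x u y Sx Su Sy (esym ux) xy) => // ->; rewrite eqxx.
have RS x : x \in R -> x \in S by rewrite inE => /andP[].
have CS x : x \in C -> x \in S by rewrite inE => /andP[].
have RC x y : x \in R -> y \in C -> x.1 != y.1 /\ x.2 != y.2.
  move=> Rx Cy; have nyx : y <> x by move=> e; move: Cy; rewrite inE e Rx.
  split; apply/eqP=> e; apply: nyx.
    exact: RP Rx (CS _ Cy) (esym e).
  exact: CP Cy (RS _ Rx) (esym e).
have cardR : #|fst @: R| = #|R|.
  by apply: card_in_imset => x y Rx Ry; apply: RP => //; apply: RS.
have cardC : #|snd @: C| = #|C|.
  by apply: card_in_imset => x y Cx Cy; apply: CP => //; apply: CS.
rewrite cardS -cardR -cardC.
(* If [R] is empty, the bound [#|B|] suffices because [#|A|] is at least 2; symmetrically if [C] is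
   empty. *)
have [->|[x Rx]] := set_0Vmem R.
  rewrite imset0 cards0 add0n (leq_trans (max_card _)) //.
  by rewrite addnC -addnBA // leq_addr.
have [->|[y Cy]] := set_0Vmem C.
  rewrite imset0 cards0 addn0 (leq_trans (max_card _)) //.
  by rewrite -addnBA // leq_addr.
(* With both parts nonempty, [y] bars one row from [R] and [x] bars one column from [C], which
   accounts for the 2 subtracted. *)
have subR : fst @: R \subset [set~ y.1].
  apply/subsetP=> _ /imsetP[z Rz ->]; rewrite !inE.
  by have [] := RC _ _ Rz Cy.
have subC : snd @: C \subset [set~ x.2].
  apply/subsetP=> _ /imsetP[z Cz ->]; rewrite !inE eq_sym.
  by have [] := RC _ _ Rx Cz.
have := leq_add (subset_leq_card subR) (subset_leq_card subC).
rewrite !cardsC1; move/leq_trans; apply.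
by case: #|A| A2 => // a _; case: #|B| B2 => // b _; rewrite addSn addnS subSS subn1.
Qed.

Lemma general_position_complete2 (n1 n2 : nat)
    (S : {set cartesian (complete n1) (complete n2)}) :
  general_position S ->
  {in S & &, forall w u v, w.1 = u.1 -> w.2 = v.2 -> w = u \/ w = v}.
Proof.
move=> /forall_inP gpS w u v Sw Su Sv wu wv.
have /forall_inP/(_ u Su)/forall_inP/(_ v Sv)/implyP := gpS w Sw.
have [->|nwu] := eqVneq w u; first by left.
have [->|nwv] := eqVneq w v; first by right.
(* The corner [(a, b)] is a common neighbour of [(a, b')] and [(a', b)], which differ in both
   coordinates and so are not adjacent. *)
case: w u v wu wv nwu nwv {Sw Su Sv} => [a b] [_ b'] [a' _] /= <- <- nbb' naa'.
have bb' : b' != b by apply: contraNneq nbb' => ->.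
have aa' : a != a' by apply: contraNneq naa' => ->.
have uv : ((a, b') : cartesian (complete n1) (complete n2)) != (a', b).
  by apply: contraNneq aa' => -[->].
case/(_ uv)/negP; apply: on_geodesic_common_neighbour => //.
- by rewrite /edge /= /cartesian_edge /= eqxx /edge /= /complete_edge bb' orbT.
- by rewrite /edge /= /cartesian_edge /= eqxx /edge /= /complete_edge aa'.
- by rewrite /edge /= /cartesian_edge /= (negPf aa') (negPf bb') andbF.
Qed.

Theorem theorem3p2 :
  (forall (k : nat) (n : 'I_k -> nat),
      2 <= k -> (forall i : 'I_k, 2 <= n i) ->
      gp (cartesian_seq [seq complete (n i) | i <- enum 'I_k])
        >= \sum_(i < k) n i - k) /\
  (forall n1 n2 : nat,
      2 <= n1 -> 2 <= n2 ->
      gp (cartesian (complete n1) (complete n2)) = n1 + n2 - 2).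
Proof.
have lower ns : all (leq 1) ns ->
    \sum_(m <- ns) (m - 1) <= gp (cartesian_seq (map complete ns)).
  by move/rooted_cluster_cartesian_seq => [r [S [rS <-]]]; apply: rooted_cluster_gp rS.
split=> [k n _ n2 | n1 n2 n1_ge2 n2_ge2].
  have n1 i : 1 <= n i by apply: ltnW.
  have := lower [seq n i | i <- enum 'I_k].
  (* Subtraction is truncated: splitting the sum of [n i - 1] relies on each [n i] being
     positive. *)
  rewrite -map_comp big_map big_enum /= sumnB // sum_nat_const card_ord muln1.
  by apply; apply/allP=> _ /mapP[i _ ->].
apply/eqP; rewrite eqn_leq; apply/andP; split.
  apply/bigmax_leqP=> S /general_position_complete2 cfS.
  by have := corner_free_card _ _ cfS; rewrite !card_ord; apply.
have := lower [:: n1; n2]; rewrite /= big_cons big_seq1.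
rewrite addnBA ?addnBAC ?(ltnW n1_ge2) ?(ltnW n2_ge2) // -subnDA.
by apply.
Qed.
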